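(* Let $H:\mathbb{R}^{2n}\to\mathbb{R}$ be a smooth function such that the Hamiltonian vector field is affine: $f(x):=J_n^{-1}\nabla H(x)=Ax+c$ for all $x\in\mathbb{R}^{2n}$, with $A\in\mathbb{R}^{2n\times 2n}$ and $c\in\mathbb{R}^{2n}$. Let $U\in\mathbb{R}^{2n\times 2k}$ be symplectic, i.e. $U^TJ_nU=J_k$, and set $U^\dagger=J_k^{-1}U^TJ_n$ and $F=U^\dagger A U$. Then for every $x\in\mathbb{R}^{2n}$ and every step size $h\in\mathbb{R}$, the vector $$x_+=x+h\,U\,\phi(hF)\,U^\dagger f(x)$$ satisfies $H(x_+)=H(x)$.
   Context: For a positive integer $m$, $J_m=\begin{bmatrix}0&I_m\\-I_m&0\end{bmatrix}\in\mathbb{R}^{2m\times2m}$. The entire function $\phi$ is $\phi(z)=\int_0^1 e^{tz}\,dt=z^{-1}(e^z-1)$ (with $\phi(0)=1$), applied to square matrices through its power series. The map $x\mapsto x_+$ is the exponential Euler method applied, from $\xi=0$, to the projected system $\xi'(t)=U^\dagger f(x+U\xi(t))$ in $\mathbb{R}^{2k}$. *)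

(* Defs.v *)
From mathcomp Require Import all_boot all_order all_algebra.
From mathcomp Require Import all_classical all_reals all_analysis.
From mathcomp Require Import ring.

Set Implicit Arguments.
Unset Strict Implicit.
Unset Printing Implicit Defensive.

Import Order.TTheory GRing.Theory Num.Theory numFieldNormedType.Exports.

Local Open Scope classical_set_scope.
Local Open Scope ring_scope.

(* [Cdiff r f] : f is of class C^r. A function is of class C^(r+1) when it is
   Frechet differentiable everywhere and x |-> Df(x) is of class C^r; since
   the domain is finite-dimensional, the latter is required pointwise, i.e. of
   x |-> Df(x) v for every vector v. *)
Fixpoint Cdiff (R : realType) (m r : nat) (f : 'cV[R]_m -> R) : Prop :=
  if r is r'.+1 then
    (forall x, differentiable f x) /\ (forall v, Cdiff r' (fun x => 'd f x v))
  else continuous f.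

Definition smooth (R : realType) (m : nat) (f : 'cV[R]_m -> R) : Prop :=
  forall r, Cdiff r f.

Definition grad (R : realType) (m : nat) (f : 'cV[R]_m -> R) (x : 'cV[R]_m) :
    'cV[R]_m :=
  \col_i 'D_(delta_mx i 0) f x.

Definition Jmx (R : realType) (m : nat) : 'M[R]_(m + m) :=
  block_mx 0 1%:M (- 1%:M) 0.
Arguments Jmx {R} m.

Definition ham_field (R : realType) (n : nat) (H : 'cV[R]_(n + n) -> R)
    (x : 'cV[R]_(n + n)) : 'cV[R]_(n + n) :=
  invmx (Jmx n) *m grad H x.

Definition symplectic (R : realType) (n k : nat) (U : 'M[R]_(n + n, k + k)) :
    Prop :=
  U^T *m Jmx n *m U = Jmx k.

Definition symp_inv (R : realType) (n k : nat) (U : 'M[R]_(n + n, k + k)) :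
    'M[R]_(k + k, n + n) :=
  invmx (Jmx k) *m U^T *m Jmx n.

(* The Taylor coefficients at 0 of phi(z) = (e^z - 1) / z. *)
Definition phi_coeff (R : realType) (j : nat) : R := (j.+1)`!%:R^-1.

Lemma phi_coeffE (R : realType) (z : R) : z != 0 ->
  series (fun j => phi_coeff R j * z ^+ j) @ \oo --> (expR z - 1) / z.
Proof.
move=> z0.
have -> : series (fun j => phi_coeff R j * z ^+ j) =
    (fun N => (series (exp_coeff z) N.+1 - 1) / z).
  apply/funext => N; rewrite !seriesEnat /= big_nat_recl //=.
  rewrite /exp_coeff /= expr0 fact0 divr1 addrAC subrr add0r mulr_suml.
  apply: eq_bigr => j _.
  by rewrite /phi_coeff exprS; field; rewrite z0 pnatr_eq0 -lt0n fact_gt0.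
apply: cvgM; last exact: cvg_cst.
apply: cvgB; last exact: cvg_cst.
by rewrite (cvg_shiftS (series (exp_coeff z))); exact: is_cvg_series_exp_coeff.
Qed.

Definition phi_mx (R : realType) (m : nat) (M : 'M[R]_m) : 'M[R]_m :=
  limn (series (fun j => phi_coeff R j *: (M ^+ j : 'M[R]_m))).

(* Main.v *)
(* The curve xi(s) = s phi(sF) w, with w = U^dagger f(x), solves the projected
   equation xi' = w + F xi, and U^T grad H(x + U xi) = J_k xi' along it, because
   J_k U^dagger = U^T J_n. Hence d/ds H(x + U xi(s)) = xi'^T J_k xi' = 0, and
   x_+ = x + U xi(h) has the same energy as x = x + U xi(0). *)
Require Import Defs.
From mathcomp Require Import all_boot all_order all_algebra.
From mathcomp Require Import all_classical all_reals all_analysis.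
From mathcomp Require Import ring.

Import Order.TTheory GRing.Theory Num.Theory numFieldNormedType.Exports.

Local Open Scope ring_scope.

Lemma cvg_mx {R : realType} {T : Type} {F : set_system T} {FF : Filter F}
    {m n : nat} (M : T -> 'M[R]_(m, n)) (L : 'M[R]_(m, n)) :
  (forall i j, (M t i j @[t --> F] --> L i j)%classic) ->
  (M t @[t --> F] --> L)%classic.
Proof.
move=> ML; apply/cvgrPdist_le => /= e e0; near=> t.
rewrite /Num.Def.normr/= mx_normrE; apply: bigmax_le; first exact: ltW.
move=> i _; rewrite !mxE/=.
move: i; near: t; apply: filter_forall => /= i.
exact: ((cvgrPdist_le _ _).1 (ML i.1 i.2)).
Unshelve. all: by end_near. Qed.

Lemma is_derive_mx {R : realType} {m n : nat} (M : R -> 'M[R]_(m, n))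
    (dM : 'M[R]_(m, n)) (t : R) :
  (forall i j, is_derive t 1 (fun s => M s i j) (dM i j)) -> is_derive t 1 M dM.
Proof.
move=> dMij; have dvM : derivable M t 1.
  by apply/derivable_mxP => i j; have [] := dMij i j.
apply: DeriveDef => //; rewrite derive_mx//; apply/matrixP => i j.
by rewrite mxE; have [] := dMij i j.
Qed.

Lemma is_derive_coord {R : realType} {m n : nat} (M : R -> 'M[R]_(m, n))
    (dM : 'M[R]_(m, n)) (t : R) i j :
  is_derive t 1 M dM -> is_derive t 1 (fun s => M s i j) (dM i j).
Proof.
move=> [dvM <-]; rewrite derive_mx// mxE.
by apply: DeriveDef => //; exact: (derivable_mxP M t 1).1.
Qed.

(** Each entry of the product is a fixed linear combination of entries of [M s], so linearity of the
    scalar derivative suffices. *)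
Lemma is_derive_mulmx {R : realType} {m n p : nat} (P : 'M[R]_(p, m))
    (M : R -> 'M[R]_(m, n)) (dM : 'M[R]_(m, n)) (t : R) :
  is_derive t 1 M dM -> is_derive t 1 (fun s => P *m M s) (P *m dM).
Proof.
move=> dvM; apply: is_derive_mx => i j; rewrite mxE.
have -> : (fun s => (P *m M s) i j) =
    \sum_k (fun s => P i k *: M s k j).
  by apply/funext => s; rewrite mxE fct_sumE.
by apply: is_derive_sum => k; apply: is_deriveZ; exact: is_derive_coord.
Qed.

Lemma is_derive_mulmxr {R : realType} {m n p : nat} (Q : 'M[R]_(n, p))
    (M : R -> 'M[R]_(m, n)) (dM : 'M[R]_(m, n)) (t : R) :
  is_derive t 1 M dM -> is_derive t 1 (fun s => M s *m Q) (dM *m Q).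
Proof.
move=> dvM; apply: is_derive_mx => i j; rewrite mxE.
have -> : (fun s => (M s *m Q) i j) =
    \sum_k (fun s => Q k j *: M s i k).
  apply/funext => s; rewrite mxE fct_sumE.
  by apply: eq_bigr => k _; rewrite mulrC.
have -> : \sum_k dM i k * Q k j = \sum_k Q k j *: dM i k.
  by apply: eq_bigr => k _; rewrite mulrC.
by apply: is_derive_sum => k; apply: is_deriveZ; exact: is_derive_coord.
Qed.

(** Comparison with [K] times the exponential series at [|C| |x|]. Coefficients are kept in the form
    [d j / j!] because differentiation then merely shifts [d]. *)
Lemma cvg_pseries_exp_bound {R : realType} (d : nat -> R) (K C x : R) :
  (forall j, `|d j| <= K * C ^+ j) ->
  cvgn (pseries (fun j => d j / j`!%:R) x).
Proof.
move=> dle; apply: normed_cvg.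
(* The sign of [K] is read off the bound at [j = 0]. *)
have K0 : 0 <= K by rewrite -[K]mulr1 -(expr0 C) (le_trans _ (dle 0%N)).
apply: (@series_le_cvg _ _ (K *: exp_coeff (`|C| * `|x|))).
- by move=> j; exact: normr_ge0.
- by move=> j; rewrite mulr_ge0// exp_coeff_ge0// mulr_ge0.
- move=> j; have -> : (K *: exp_coeff (`|C| * `|x|)) j =
      K * `|C| ^+ j * `|x| ^+ j / j`!%:R.
    transitivity (K * exp_coeff (`|C| * `|x|) j) => //.
    by rewrite /exp_coeff /= exprMn !mulrA.
  rewrite /= !normrM normfV normrX normr_nat mulrAC.
  rewrite ler_wpM2r ?invr_ge0// ler_wpM2r ?exprn_ge0//.
  by rewrite (le_trans (dle j))// ler_wpM2l// -normrX ler_norm.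
- by apply: is_cvg_seriesZ; exact: is_cvg_series_exp_coeff.
Qed.

(** Shifting [d] preserves the geometric bound, with [K * C] in place of [K]. Hence the series and
    its first two formal derivatives all converge, which permits termwise differentiation. *)
Lemma is_derive_pseries_exp_bound {R : realType} (d : nat -> R) (K C x : R) :
  (forall j, `|d j| <= K * C ^+ j) ->
  is_derive x 1 (fun y => limn (pseries (fun j => d j / j`!%:R) y))
    (limn (pseries (fun j => d j.+1 / j`!%:R) x)).
Proof.
have diffsE (e : nat -> R) : pseries_diffs (fun j => e j / j`!%:R) =
    (fun j => e j.+1 / j`!%:R).
  apply/funext => j; rewrite /pseries_diffs factS natrM invfM mulrCA.
  by rewrite mulVKf// pnatr_eq0.
have shift_le (e : nat -> R) (L : R) : (forall j, `|e j| <= L * C ^+ j) ->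
    forall j, `|e j.+1| <= L * C * C ^+ j.
  by move=> ele j; rewrite -mulrA -exprS.
move=> dle; rewrite -diffsE.
(* Convergence is checked at a point of modulus strictly larger than [|x|]; [|x| + 1] is one such
   choice. *)
apply: (@pseries_snd_diffs _ _ (`|x| + 1)); rewrite ?diffsE.
- exact: cvg_pseries_exp_bound dle.
- exact: cvg_pseries_exp_bound (shift_le _ _ dle).
- exact: cvg_pseries_exp_bound (shift_le _ _ (shift_le _ _ dle)).
- by rewrite [ltRHS]ger0_norm ?ltrDl// addr_ge0.
Qed.

(** The base dominates every absolute row sum of [F], so each left multiplication by [F] enlarges
    entries by at most this factor. The summand 1 makes the powers nondecreasing in [j], which later
    absorbs an index shift. *)
Lemma norm_mxpow_le {R : realType} {m : nat} (F : 'M[R]_m) j a b :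
  `|(F ^+ j : 'M[R]_m) a b| <= (1 + \sum_i \sum_l `|F i l|) ^+ j.
Proof.
set C := 1 + _.
have S0 : 0 <= \sum_i \sum_l `|F i l| by do 2 apply: sumr_ge0 => ? _.
have C0 : 0 <= C by rewrite addr_ge0.
elim: j a b => [|j IHj] a b.
  by rewrite !expr0 mxE; case: (a == b); rewrite ?normr1 ?normr0.
rewrite [X in _ <= X]exprS exprS mxE.
apply: le_trans (ler_norm_sum _ _ _) _.
apply: (@le_trans _ _ (\sum_l `|F a l| * C ^+ j)).
  by apply: ler_sum => l _; rewrite normrM ler_wpM2l.
rewrite -mulr_suml ler_wpM2r ?exprn_ge0//.
rewrite /C [X in _ <= 1 + X](bigD1 a)//= addrCA lerDl addr_ge0//.
by do 2 apply: sumr_ge0 => ? _.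
Qed.

Lemma exprZmx {R : realType} {m : nat} (F : 'M[R]_m) (t : R) j :
  (t *: F) ^+ j = t ^+ j *: (F ^+ j : 'M[R]_m).
Proof.
elim: j => [|j IHj]; first by rewrite !expr0 scale1r.
rewrite !exprS IHj -[LHS]/(_ *m _) -[F * _]/(F *m _).
by rewrite -scalemxAl -scalemxAr scalerA.
Qed.

(** The factor [t] raises the exponent to match the factorial: t phi(tF) is the sum over j >= 1 of
    F^(j-1) t^j / j!. The [match] encodes this shift, with zero constant term. *)
Lemma phi_mxE {R : realType} {m : nat} (F : 'M[R]_m) (t : R) a b :
  t * phi_mx (t *: F) a b =
  limn (pseries (fun j => (if j is j'.+1 then (F ^+ j' : 'M[R]_m) a b else 0)
                          / j`!%:R) t).
Proof.
set C := 1 + \sum_i \sum_l `|F i l|.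
(* Splitting 1/(j+1)! as (1/(j+1))/j! brings the entries of phi(tF) under the exponential bound. *)
pose u a b := pseries (fun j => ((F ^+ j : 'M[R]_m) a b / j.+1%:R) / j`!%:R) t.
have cu a' b' : cvgn (u a' b').
  apply: (@cvg_pseries_exp_bound _ _ 1 C) => j; rewrite mul1r.
  rewrite normrM (le_trans _ (norm_mxpow_le F j a' b'))// ler_piMr//.
  by rewrite normfV normr_nat invf_le1 ?ltr0n// ler1n.
have uE N : series (fun j => phi_coeff R j *: ((t *: F) ^+ j : 'M[R]_m)) N =
    \matrix_(a, b) u a b N.
  apply/matrixP => a' b'; rewrite mxE /u /pseries !seriesEnat summxE.
  apply: eq_bigr => j _; rewrite mxE /phi_coeff exprZmx mxE factS natrM /=.
  by field; rewrite nat1r !pnatr_eq0 -lt0n fact_gt0.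
have -> : phi_mx (t *: F) = \matrix_(a, b) limn (u a b).
  rewrite /phi_mx (funext uE); apply: cvg_lim; first exact: norm_hausdorff.
  apply: cvg_mx => i j; rewrite mxE.
  by under eq_fun do rewrite mxE; exact: cu.
rewrite mxE; apply/esym/cvg_lim => //.
rewrite -cvg_shiftS.
have -> : [sequence (pseries (fun j => (if j is j'.+1 then (F ^+ j' : 'M[R]_m) a b
    else 0) / j`!%:R) t) n.+1]_n = (fun n => t * u a b n).
  apply/funext => n; rewrite /u /pseries !seriesEnat /= big_nat_recl//.
  rewrite !mul0r add0r mulr_sumr; apply: eq_bigr => j _.
  rewrite factS natrM exprS.
  by field; rewrite nat1r !pnatr_eq0 -lt0n fact_gt0.
exact: cvgMr (cu _ _).
Qed.

(** Termwise differentiation gives the series of e^(tF); splitting off its constant term I and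
    factoring [F] out of the rest leaves I + F (t phi(tF)). This form is the linear equation that
    [xi] has to satisfy. *)
Lemma is_derive_phi_mx {R : realType} {m : nat} (F : 'M[R]_m) (t : R) :
  is_derive t 1 (fun s => s *: phi_mx (s *: F))
    (1%:M + F *m (t *: phi_mx (t *: F))).
Proof.
set C := 1 + \sum_i \sum_l `|F i l|.
pose d a b j := if j is j'.+1 then (F ^+ j' : 'M[R]_m) a b else 0.
have C1 : 1 <= C by rewrite lerDl; do 2 apply: sumr_ge0 => ? _.
have dle a b j : `|d a b j| <= 1 * C ^+ j.
  rewrite mul1r; case: j => [|j]; first by rewrite normr0 expr0 ler01.
  by rewrite (le_trans (norm_mxpow_le F j a b))// ler_weXn2l.
apply: is_derive_mx => a b.
have -> : (fun s => (s *: phi_mx (s *: F)) a b) =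
    (fun s => limn (pseries (fun j => d a b j / j`!%:R) s)).
  by apply/funext => s; rewrite mxE phi_mxE.
apply: is_derive_eq; first exact: is_derive_pseries_exp_bound (dle a b).
rewrite !mxE; apply: cvg_lim => //; rewrite -cvg_shiftS.
(* Both sides are truncated at [n.+1]: the term [j = 0] on the left is the entry of I, while on the
   right [d l b 0 = 0], and the other terms match by F^(j+1) = F F^j. *)
have -> : [sequence (pseries (fun j => d a b j.+1 / j`!%:R) t) n.+1]_n =
    (fun n => (a == b)%:R +
      \sum_l F a l * pseries (fun j => d l b j / j`!%:R) t n.+1).
  apply/funext => n; rewrite /pseries !seriesEnat /= big_nat_recl//=.
  rewrite !expr0 mxE divr1 mulr1; congr (_ + _).
  under [RHS]eq_bigr => l _.
    rewrite seriesEnat/= big_nat_recl//= !mul0r add0r mulr_sumr; over.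
  rewrite exchange_big/=; apply: eq_bigr => j _.
  rewrite exprS [X in X / _](_ : _ = \sum_l F a l * (F ^+ j : 'M[R]_m) l b);
    last by rewrite mxE.
  by rewrite !mulr_suml; apply: eq_bigr => l _; rewrite !mulrA.
apply: cvgD; first exact: cvg_cst.
apply: cvg_big => [|l _]; first exact: add_continuous.
apply: cvgMr.
rewrite mxE phi_mxE cvg_shiftS.
exact: cvg_pseries_exp_bound (dle l b).
Qed.

Lemma diff_grad {R : realType} {m : nat} (f : 'cV[R]_m -> R) (x v : 'cV[R]_m) :
  differentiable f x -> 'd f x v = (v^T *m grad f x) 0 0.
Proof.
move=> df; rewrite [in LHS](matrix_sum_delta v) linear_sum mxE.
apply: eq_bigr => i _; rewrite big_ord1 linearZ/= !mxE deriveE//.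
Qed.

Lemma is_derive_comp_grad {R : realType} {m : nat} (f : 'cV[R]_m -> R)
    (g : R -> 'cV[R]_m) (dg : 'cV[R]_m) (t : R) :
  differentiable f (g t) -> is_derive t 1 g dg ->
  is_derive t 1 (f \o g) ((dg^T *m grad f (g t)) 0 0).
Proof.
move=> df [dvg <-]; have /derivable1_diffP dfg := dvg.
have dfog : differentiable (f \o g) t by exact: differentiable_comp.
apply: DeriveDef; first exact/derivable1_diffP.
rewrite (deriveE _ dfog) (diff_comp dfg df).
by rewrite [LHS]diff_grad// (deriveE _ dfg).
Qed.

Lemma mulmx_Jmx_opp {R : realType} (n : nat) :
  Jmx n *m - Jmx n = 1%:M :> 'M[R]_(n + n).
Proof.
rewrite /Jmx mulmxN mulmx_block !mul0mx !mulmx0 mul1mx mulmx1.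
by rewrite !add0r !addr0 opp_block_mx opprK oppr0 -scalar_mx_block.
Qed.

Lemma Jmx_unit {R : realType} (n : nat) : Jmx n \in @unitmx R _.
Proof. by have [] := mulmx1_unit (@mulmx_Jmx_opp R n). Qed.

Lemma tr_Jmx {R : realType} (n : nat) : (Jmx n)^T = - Jmx n :> 'M[R]_(n + n).
Proof.
by rewrite /Jmx tr_block_mx opp_block_mx !trmx0 linearN/= trmx1 opprK !oppr0.
Qed.

(** The 1 by 1 matrix equals its own transpose entrywise, yet transposition changes its sign because
    [Jmx n] is skew, so twice its entry is 0. *)
Lemma Jmx_isotropic {R : realType} (n : nat) (v : 'cV[R]_(n + n)) :
  v^T *m Jmx n *m v = 0.
Proof.
have : (v^T *m Jmx n *m v)^T = - (v^T *m Jmx n *m v).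
  by rewrite !trmx_mul trmxK tr_Jmx mulNmx mulmxN mulmxA.
move: (_ *m v) => q /matrixP qT; apply/matrixP => i j; rewrite !ord1.
have := qT 0 0; rewrite !mxE => /eqP.
by rewrite -addr_eq0 -mulr2n mulrn_eq0 => /eqP.
Qed.

Theorem lemma1 (R : realType) (n k : nat) (n_gt0 : (0 < n)%N) (k_gt0 : (0 < k)%N)
  (H : 'cV[R]_(n + n) -> R) (A : 'M[R]_(n + n)) (c : 'cV[R]_(n + n))
  (U : 'M[R]_(n + n, k + k)) :
  smooth H ->
  (forall x, ham_field H x = A *m x + c) ->
  symplectic U ->
  let F := symp_inv U *m A *m U in
  forall (x : 'cV[R]_(n + n)) (h : R),
  let xplus :=
    x + h *: (U *m phi_mx (h *: F) *m symp_inv U *m ham_field H x) in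
  H xplus = H x.
Proof.
move=> smH fE sympU F x h xplus.
have diffH y : differentiable H y by have [+ _] := smH 1%N; exact.
pose w := symp_inv U *m ham_field H x.
pose xi (s : R) : 'cV[R]_(k + k) := s *: phi_mx (s *: F) *m w.
pose g (s : R) : 'cV[R]_(n + n) := x + U *m xi s.
have dxi (t : R) : is_derive t 1 xi (w + F *m xi t).
  apply: is_derive_eq; first exact: is_derive_mulmxr (is_derive_phi_mx F t).
  by rewrite mulmxDl mul1mx -mulmxA.
have dg (t : R) : is_derive t 1 g (U *m (w + F *m xi t)).
  have -> : g = cst x + (fun s => U *m xi s) by [].
  rewrite -[X in is_derive _ _ _ X]add0r.
  exact: (is_deriveD (is_derive_cst _ _ _) (is_derive_mulmx _ _ _ _ (dxi t))).
have gradE y : grad H y = Jmx n *m ham_field H y.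
  by rewrite /ham_field mulmxA mulmxV ?mul1mx// Jmx_unit.
have Jsymp : Jmx k *m symp_inv U = U^T *m Jmx n.
  by rewrite /symp_inv !mulmxA mulmxV ?mul1mx// Jmx_unit.
(* Affinity gives f(x + U xi) = f(x) + A U xi, which [symp_inv U] maps to [w + F *m xi t]. *)
have projE t : U^T *m grad H (g t) = Jmx k *m (w + F *m xi t).
  rewrite gradE mulmxA -Jsymp -mulmxA; congr (_ *m _).
  rewrite fE /g [A *m _]mulmxDr addrAC -fE mulmxDr; congr (_ + _).
  by rewrite /F !mulmxA.
have xplusE : xplus = g h.
  by rewrite /xplus /g /xi /w -!scalemxAl -!scalemxAr !mulmxA.
have -> : x = g 0 by rewrite /g /xi scale0r mul0mx mulmx0 addr0.
rewrite xplusE; apply: (@is_derive_0_is_cst _ (H \o g)) => t.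
apply: is_derive_eq; first exact: is_derive_comp_grad (diffH _) (dg t).
(* Transposing [U *m (w + F *m xi t)] moves U^T onto the gradient, where [projE] yields the skew
   form evaluated on xi' twice. *)
by rewrite trmx_mul -mulmxA projE mulmxA Jmx_isotropic mxE.
Qed.
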